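(* Let $\mathbf{F}_q$ be the finite field with $q$ elements. For every integer $n \geq 2$, $$cp_n(GL_2(\mathbf{F}_q)) = cp_n(U_2(\mathbf{F}_q)).$$
   Context: For a finite group $G$ and a positive integer $n$, let $G^{(n)} = \{(g_1,\ldots,g_n)\in G^n \mid g_ig_j = g_jg_i \text{ for all } 1\leq i\neq j\leq n\}$ be the set of $n$-tuples of pairwise commuting elements of $G$, and define the commuting probability $cp_n(G) = \dfrac{|G^{(n)}|}{|G|^n}$. $GL_2(\mathbf{F}_q)$ is the group of invertible $2\times 2$ matrices over $\mathbf{F}_q$, of order $q(q-1)(q^2-1)$. $U_2(\mathbf{F}_q)$ is the finite unitary group of rank $2$, i.e. the group of matrices in $GL_2(\mathbf{F}_{q^2})$ preserving a non-degenerate Hermitian form on $\mathbf{F}_{q^2}^2$ (with respect to the automorphism $x\mapsto x^q$ of $\mathbf{F}_{q^2}$; all such forms are equivalent, so one may take $\{A\in GL_2(\mathbf{F}_{q^2}) \mid \bar{A}^{T}A = I\}$, where $\bar{A}$ is obtained by raising the entries of $A$ to the $q$-th power). It has order $q(q+1)(q^2-1)$. *)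

(* Defs.v *)
From HB Require Import structures.
From mathcomp Require Import all_boot all_order all_algebra all_fingroup.
From mathcomp Require Import all_solvable all_field.

Set Implicit Arguments.
Unset Strict Implicit.
Unset Printing Implicit Defensive.

Import GRing.Theory.
Local Open Scope ring_scope.

Definition commuting_tuples (gT : finGroupType) (G : {group gT}) (n : nat) :
    {set n.-tuple gT} :=
  [set t : n.-tuple gT | [forall i, tnth t i \in G]
     && [forall i, forall j, (i != j) ==>
           (tnth t i * tnth t j == tnth t j * tnth t i)%g]].

Definition cp (n : nat) (gT : finGroupType) (G : {group gT}) : rat :=
  #|commuting_tuples G n|%:R / #|G|%:R ^+ n.

Section Unitary.

Variables (E : finFieldType) (q : nat).

Definition conj_mx (A : 'M[E]_2) : 'M[E]_2 := map_mx (fun x => x ^+ q) A.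

Definition U2_set : {set {'GL_2[E]}} :=
  [set A : {'GL_2[E]} | (conj_mx (GLval A))^T *m GLval A == 1%:M].

(* The cardinality assumption makes q a power of the characteristic, so that  *)
(* x |-> x ^+ q is the involutive automorphism of E and U2_set is a group.     *)
Hypothesis cardE : #|E| = (q ^ 2)%N.

Lemma conjD (x y : E) : (x + y) ^+ q = x ^+ q + y ^+ q.
Proof.
apply: exprDn_pchar.
have /is_abelemP[r pr_r] := finField_is_abelem E.
move/abelem_pgroup; rewrite /pgroup cardsT cardE pnatX orbF => qr.
have : r.-nat (q ^ 2)%N by rewrite pnatX qr.
rewrite -cardE => /p_natP[k Ek].
by rewrite (eq_pnat _ (pcharf_eq (card_finPcharP Ek pr_r))).
Qed.

Lemma q_gt0 : (0 < q)%N.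
Proof.
by case: q cardE => // /eqP; rewrite -leqn0 leqNgt; case/negP; apply/card_gt0P; exists 0.
Qed.

Lemma conj_mxM (A B : 'M[E]_2) : conj_mx (A *m B) = conj_mx A *m conj_mx B.
Proof.
apply/matrixP=> i j; rewrite !mxE (big_morph (fun x : E => x ^+ q) conjD (id1 := 0)).
  by apply: eq_bigr => k _; rewrite exprMn !mxE.
by rewrite expr0n eqn0Ngt q_gt0.
Qed.

Lemma conj_mx1 : conj_mx 1%:M = 1%:M.
Proof.
apply/matrixP=> i j; rewrite !mxE; case: (i == j); first by rewrite expr1n.
by rewrite expr0n eqn0Ngt q_gt0.
Qed.

Lemma U2_group_set : group_set U2_set.
Proof.
apply/group_setP; split=> [|A B].
  by rewrite inE GL_1E conj_mx1 trmx1 mulmx1.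
rewrite !inE => /eqP UA /eqP UB; rewrite GL_MxE conj_mxM trmx_mul.
by rewrite -mulmxA [X in _ *m X]mulmxA UA mul1mx UB.
Qed.

Definition U2 : {group {'GL_2[E]}} := Group U2_group_set.

End Unitary.

(* Main.v *)
From HB Require Import structures.
Require Import Defs.
From mathcomp Require Import all_boot all_order all_algebra all_fingroup.
From mathcomp Require Import all_solvable all_field ring.

(* Multiplying a group by central elements does not change which tuples       *)
(* commute, so cp_n depends only on the image of the group modulo a central   *)
(* subgroup, together with the relation "lifts commute". Both GL_2(F) and U_2 *)
(* map to GL_2(E) / Z, where Z is the centre. Writing bar for x |-> x ^+ q    *)
(* and J for the symplectic matrix, the identity A^T J A = \det A J shows     *)
(* that A is proportional to a unitary matrix iff bar A is proportional to    *)
(* J A J^-1, while A is proportional to a matrix over F iff bar A is          *)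
(* proportional to A. A matrix P with bar P = c J P conjugates the second     *)
(* condition into the first, so the two images are conjugate.                 *)

Set Implicit Arguments.
Unset Strict Implicit.
Unset Printing Implicit Defensive.

Import GRing.Theory.
Local Open Scope ring_scope.

(** Both groups are compared inside the quotient of ['GL_2[E]] by its centre. A tuple commutes or
    not according to its image there, and all fibres over the image have the size of the kernel, so
    the kernel order cancels from the ratio ([cp_morph_image], [cp_eq_image]). It remains to see
    that the two images agree after conjugation by [P]: [unitary_untwist] and [conj_mx_descent] turn
    a unitary matrix into a matrix over [F] up to a scalar, and [rational_similitude] with
    [norm_surjective] gives the converse. *)

(** * Counting commuting tuples through a homomorphism *)

Lemma card_tuple_family (T : finType) (n : nat) (A : 'I_n -> {set T}) :
  #|[set t : n.-tuple T | [forall i, tnth t i \in A i]]| = \prod_i #|A i|.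
Proof.
transitivity #|family (fun i => mem (A i))|; last first.
  by rewrite card_family foldrE big_map big_enum.
pose g (t : n.-tuple T) := [ffun i => tnth t i].
have g_inj : injective g.
  by move=> s t /ffunP e; apply: eq_from_tnth => i; have:= e i; rewrite !ffunE.
rewrite -(card_imset _ g_inj); apply: eq_card => h.
apply/imsetP/familyP => [[t + -> i]|hA].
  by rewrite inE => /forallP/(_ i); rewrite /g ffunE.
exists [tuple h i | i < n]; last by apply/ffunP => i; rewrite ffunE tnth_mktuple.
by rewrite inE; apply/forallP => i; rewrite tnth_mktuple; apply: hA.
Qed.

(** The relation is left abstract because it will mean that lifts commute, which is stronger than
    commuting in the quotient. *)
Definition related_tuples (T : finType) (B : {set T}) (R : rel T) (n : nat) :
    {set n.-tuple T} :=
  [set t : n.-tuple T | [forall i, tnth t i \in B]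
     && [forall i, forall j, (i != j) ==> R (tnth t i) (tnth t j)]].

Section QuotientCount.

Variables (gT rT : finGroupType) (G : {group gT}) (f : gT -> rT) (R : rel rT).
Hypothesis fM : {in G &, {morph f : x y / (x * y)%g}}.

Let K := [set x in G | f x == 1%g].

Lemma card_morph_fiber (y : rT) :
  y \in f @: G -> #|[set x in G | f x == y]| = #|K|.
Proof.
case/imsetP=> x0 Gx0 ->; rewrite -(card_imset K (mulIg x0)).
have f1 : f 1%g = 1%g by apply: (mulgI (f 1%g)); rewrite -fM ?mulg1.
have fV : (f x0^-1 = (f x0)^-1)%g.
  by apply: (mulgI (f x0)); rewrite -fM ?groupV // !mulgV f1.
apply: eq_card => x; rewrite inE; apply/andP/imsetP => [[Gx /eqP fx]|].
  exists (x * x0^-1)%g; rewrite ?mulgKV // inE groupM ?groupV //=.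
  by rewrite fM ?groupV // fx fV mulgV.
by case=> k; rewrite inE => /andP[Gk /eqP fk] ->; rewrite groupM // fM // fk mul1g.
Qed.

Lemma card_morph_imset : #|G| = (#|f @: G| * #|K|)%N.
Proof.
rewrite -sum1_card (partition_big_imset f) /= -sum_nat_const; apply: eq_bigr => y fy.
by rewrite -(card_morph_fiber fy) -sum1_card; apply: eq_bigl => x; rewrite inE.
Qed.

Hypothesis fR : {in G &, forall x y, R (f x) (f y) = ((x * y)%g == (y * x)%g)}.

(** By [fR] any lift of a related tuple commutes, so the fibre over it is a product of [n] fibres of
    [f], each of size [#|K|]. *)
Lemma card_commuting_tuples (n : nat) :
  #|commuting_tuples G n| = (#|related_tuples (f @: G) R n| * #|K| ^ n)%N.
Proof.
rewrite -sum1_card (partition_big (map_tuple f) [in related_tuples (f @: G) R n]).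
  rewrite -sum_nat_const; apply: eq_bigr => u; rewrite inE => /andP[/forallP uG /forallP uR].
  transitivity #|[set t : n.-tuple gT |
                  [forall i, tnth t i \in [set x in G | f x == tnth u i]]]|.
    rewrite -sum1_card; apply: eq_bigl => t; rewrite !inE.
    apply/andP/forallP => [[/andP[/forallP tG _] /eqP <-] i|tu].
      by rewrite inE tG tnth_map eqxx.
    have tG i : tnth t i \in G by have:= tu i; rewrite inE => /andP[].
    have fu i : f (tnth t i) = tnth u i by have:= tu i; rewrite inE => /andP[_ /eqP].
    split; last by apply/eqP/eq_from_tnth => i; rewrite tnth_map.
    apply/andP; split; apply/forallP => // i; apply/forallP => j.
    by have/forallP/(_ j) := uR i; rewrite -!fu fR.
  rewrite card_tuple_family -[n in (_ ^ n)%N]card_ord -prod_nat_const.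
  by apply: eq_bigr => i _; rewrite card_morph_fiber.
move=> t; rewrite !inE => /andP[/forallP tG /forallP tC].
apply/andP; split; apply/forallP => i; first by rewrite tnth_map imset_f.
by apply/forallP => j; rewrite !tnth_map fR //; move/forallP: (tC i).
Qed.

Lemma cp_morph_image (n : nat) :
  cp n G = #|related_tuples (f @: G) R n|%:R / #|f @: G|%:R ^+ n.
Proof.
rewrite /cp card_commuting_tuples card_morph_imset !natrM natrX exprMn.
rewrite -mulf_div divff ?mulr1 // expf_neq0 // Num.Theory.pnatr_eq0 -lt0n.
by have:= cardG_gt0 G; rewrite card_morph_imset muln_gt0 => /andP[].
Qed.

End QuotientCount.

Lemma cp_eq_image (gT1 gT2 rT : finGroupType) (G1 : {group gT1}) (G2 : {group gT2})
    (f1 : gT1 -> rT) (f2 : gT2 -> rT) (R : rel rT) (n : nat) :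
    {in G1 &, {morph f1 : x y / (x * y)%g}} ->
    {in G2 &, {morph f2 : x y / (x * y)%g}} ->
    {in G1 &, forall x y, R (f1 x) (f1 y) = ((x * y)%g == (y * x)%g)} ->
    {in G2 &, forall x y, R (f2 x) (f2 y) = ((x * y)%g == (y * x)%g)} ->
    f1 @: G1 = f2 @: G2 ->
  cp n G1 = cp n G2.
Proof.
move=> f1M f2M f1R f2R im12.
by rewrite (cp_morph_image f1M f1R) (cp_morph_image f2M f2R) im12.
Qed.

(** * Commutation of lifts from the central quotient *)

Definition coset_commute (gT : finGroupType) (Z : {set gT}) (a b : coset_of Z) : bool :=
  (repr a * repr b == repr b * repr a)%g.

(** The chosen representatives differ from [x] and [y] by central factors, which cancel from both
    products. *)
Lemma coset_center_commute (gT : finGroupType) (G : {group gT}) :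
  {in G &, forall x y,
     coset_commute (coset 'Z(G) x) (coset 'Z(G) y) = (x * y == y * x)%g}.
Proof.
move=> x y Gx Gy.
have nZ z : z \in G -> z \in 'N('Z(G))%g.
  by apply: subsetP; apply: normal_norm (center_normal G).
have reprP z : z \in G -> exists2 c, c \in 'Z(G)%g & (repr (coset 'Z(G) z) = c * z)%g.
  move=> Gz; have:= mem_repr_coset (coset 'Z(G) z); rewrite val_coset ?nZ //.
  by case/rcosetP=> c Zc ->; exists c.
rewrite /coset_commute; have [c Zc ->] := reprP x Gx; have [d Zd ->] := reprP y Gy.
have comm c' z : (c' \in 'Z(G) -> z \in G -> c' * z = z * c')%g.
  by case/centerP=> _; apply.
have [Gc _] := centerP _ _ Zc; have [Gd _] := centerP _ _ Zd.
have -> : (c * x * (d * y) = c * d * (x * y))%g.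
  by rewrite -!mulgA; congr (_ * _)%g; rewrite !mulgA (comm d x).
have -> : (d * y * (c * x) = c * d * (y * x))%g.
  by rewrite -!mulgA (comm c (d * (y * x))%g) ?groupM // -!mulgA -(comm c x).
exact: (inj_eq (mulgI _)).
Qed.

(** * Embeddings of finite fields *)

Lemma finField_unity (F : finFieldType) (x : F) : x != 0 -> x ^+ #|F|.-1 = 1.
Proof.
move=> x0; apply: (mulfI x0); rewrite mulr1 -exprS prednK ?expf_card //.
by apply/card_gt0P; exists 0.
Qed.

Lemma finField_prim_root (F : finFieldType) :
  exists w : F, (#|F|.-1).-primitive_root w.
Proof.
have F_gt0 : (0 < #|F|.-1)%N.
  by rewrite -ltnS prednK ?finNzRing_gt1 // (ltnW (finNzRing_gt1 F)).
have /hasP[w _ wP] : has (#|F|.-1).-primitive_root (enum [set~ (0 : F)]).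
  apply: has_prim_root; rewrite ?enum_uniq //; last by rewrite -cardE cardsC1.
  apply/allP => x; rewrite mem_enum !inE => x0.
  by apply/unity_rootP/finField_unity.
by exists w.
Qed.

(** [m] is an annihilating polynomial of least size: the remainder of [P] modulo [m] also vanishes
    at [a] and is smaller, hence zero. *)
Lemma poly_annihilator_gen (k : finFieldType) (L : idomainType)
    (i : {rmorphism k -> L}) (P0 : {poly k}) (a : L) :
    P0 != 0 -> root (map_poly i P0) a ->
  exists2 m : {poly k}, root (map_poly i m) a &
    forall P, root (map_poly i P) a -> m %| P.
Proof.
move=> P0n0 P0a.
pose ann (P : {poly k}) := (P != 0) && root (map_poly i P) a.
(* Coefficient tuples of a given length form a finite type, so the property of [s] is boolean, as
   [ex_minnP] requires. *)
have exs : exists s, [exists t : s.-tuple k, ann (Poly t)].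
  exists (size P0); apply/existsP; exists (in_tuple P0).
  by rewrite /ann /= polyseqK P0n0.
case: (ex_minnP exs) => s /existsP[t /andP[t0 ta]] s_min; exists (Poly t) => // P Pa.
have ra : root (map_poly i (P %% Poly t)) a.
  move: Pa; rewrite {1}(divp_eq P (Poly t)) rmorphD rmorphM /= !rootE !hornerE.
  by rewrite (rootP ta) mulr0 add0r.
apply/modp_eq0P/eqP; apply: contraT; set r := P %% Poly t in ra * => r0.
have s_le : (s <= size r)%N.
  by apply: s_min; apply/existsP; exists (in_tuple r); rewrite /ann /= polyseqK r0.
have: (size r < size (Poly t))%N by rewrite ltn_modp.
by rewrite ltnNge (leq_trans (size_Poly t)) // size_tuple.
Qed.

(* A primitive root w of F is sent to a root in E of a generator of the ideal *)
(* of w; such a root exists because the generator divides 'X^#|E| - 'X.       *)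
Lemma finField_embedding_over (k F E : finFieldType) (d : nat)
    (iF : {rmorphism k -> F}) (iE : {rmorphism k -> E}) :
  #|E| = (#|F| ^ d)%N -> inhabited {rmorphism F -> E}.
Proof.
move=> cardE; have [w wP] := finField_prim_root F.
have wE : root (map_poly iF ('X^#|E| - 'X)) w.
  rewrite rootE rmorphB /= map_polyXn map_polyX !hornerE cardE subr_eq0; apply/eqP.
  by elim: d {cardE} => // d IHd; rewrite expnSr exprM IHd expf_card.
have nz : ('X^#|E| - 'X : {poly k}) != 0.
  rewrite -size_poly_eq0 size_polyDl ?size_polyXn // size_polyN size_polyX.
  by rewrite ltnS finNzRing_gt1.
have [m mw m_gen] := poly_annihilator_gen nz wE.
have [z mz] : exists z, root (map_poly iE m) z.
  have := m_gen _ wE; rewrite -(dvdp_map iE) rmorphB /= map_polyXn map_polyX.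
  rewrite finField_genPoly => /dvdp_prod_XsubC[b].
  case: (mask b _) => [|z r]; last first.
    move=> /eqp_root mr; exists z.
    by rewrite mr big_cons rootM root_XsubC eqxx.
  (* With no linear factor, [m] would be a nonzero constant, which cannot vanish at [w]. *)
  rewrite big_nil -size_poly_eq1 size_map_poly => /size_poly1P[c c0 mc].
  by move: mw; rewrite mc map_polyC rootC /= fmorph_eq0 (negPf c0).
(* Every element of [F] is a polynomial in [w]; sending [w] to [z] is well defined because [m]
   divides every relation satisfied by [w]. *)
pose evF P := (map_poly iF P).[w]; pose evE P := (map_poly iE P).[z].
have ev_eq P Q : evF P = evF Q -> evE P = evE Q.
  move/eqP; rewrite -subr_eq0 -hornerN -hornerD -rmorphB => /m_gen PQ.
  apply/eqP; rewrite -subr_eq0 -hornerN -hornerD -rmorphB /=.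
  by apply: (root_dvdp _ mz); rewrite dvdp_map.
have exP x : exists P, evF P == x.
  have [->|x0] := eqVneq x 0; first by exists 0; rewrite /evF rmorph0 horner0.
  have [j ->] := prim_rootP wP (finField_unity x0).
  by exists ('X^j); rewrite /evF map_polyXn hornerXn.
pose g x := evE (xchoose (exP x)).
have gE P : g (evF P) = evE P by apply: ev_eq; apply/eqP/(xchooseP (exP _)).
have evFP x : exists P, x = evF P by have [P /eqP <-] := exP x; exists P.
have gB : zmod_morphism g.
  move=> x y; have [P ->] := evFP x; have [Q ->] := evFP y.
  have -> : evF P - evF Q = evF (P - Q) by rewrite /evF rmorphB hornerD hornerN.
  by rewrite !gE /evE rmorphB hornerD hornerN.
have gM : monoid_morphism g.
  split=> [|x y].
    have e1 : evF 1 = 1 by rewrite /evF rmorph1 hornerC.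
    by rewrite -e1 gE /evE rmorph1 hornerC.
  have [P ->] := evFP x; have [Q ->] := evFP y.
  have -> : evF P * evF Q = evF (P * Q) by rewrite /evF rmorphM hornerM.
  by rewrite !gE /evE rmorphM hornerM.
pose gA := GRing.isZmodMorphism.Build F E g gB.
pose gR := GRing.isMonoidMorphism.Build F E g gM.
by constructor; exact: (HB.pack g gA gR).
Qed.

(** The cardinalities force a common characteristic, so both fields are algebras over the same
    ['F_p]. *)
Lemma finField_embedding (F E : finFieldType) (d : nat) :
  #|E| = (#|F| ^ d)%N -> inhabited {rmorphism F -> E}.
Proof.
move=> cardE; have [p p_pr pF] := finPcharP F.
have pE : p \in [pchar E].
  by apply: card_finPcharP p_pr; rewrite cardE (card_pprimeChar pF) -expnM.
pose iF : {rmorphism 'F_p -> F} :=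
  GRing.RMorphism.clone 'F_p (pPrimeCharType pF) (in_alg (pPrimeCharType pF)) _.
pose iE : {rmorphism 'F_p -> E} :=
  GRing.RMorphism.clone 'F_p (pPrimeCharType pE) (in_alg (pPrimeCharType pE)) _.
exact (finField_embedding_over iF iE cardE).
Qed.

(** * The [q]-power map on a field with [q ^ 2] elements *)

Section Frobenius.

Variables (E : finFieldType) (q : nat).
Hypothesis cardE : #|E| = (q ^ 2)%N.

Lemma sqrt_card_gt1 : (1 < q)%N.
Proof.
rewrite ltnNge; apply/negP => q1; have:= finNzRing_gt1 E.
by rewrite cardE; case: q q1 => [|[]].
Qed.

Lemma card_frobenius_fixed : (#|[set x : E | x ^+ q == x]| <= q)%N.
Proof.
rewrite fintype.cardE -ltnS.
have s : size ('X^q - 'X : {poly E}) = q.+1.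
  by rewrite size_polyDl ?size_polyXn // size_polyN size_polyX ltnS sqrt_card_gt1.
rewrite -s; apply: max_poly_roots; rewrite ?enum_uniq // -?size_poly_eq0 ?s //.
by apply/allP => x; rewrite mem_enum inE rootE !hornerE subr_eq0.
Qed.

Lemma frobenius_nonfixed : exists y : E, y ^+ q != y.
Proof.
apply/existsP; apply: contraT; rewrite negb_exists => /forallP fix_all.
have:= card_frobenius_fixed; rewrite (_ : [set x | _] = setT); last first.
  by apply/setP => x; rewrite !inE -[_ == _]negbK fix_all.
by rewrite cardsT cardE -{2}[q]expn1 leq_exp2l // sqrt_card_gt1.
Qed.

(** The image of [g] has [q] elements, all fixed, and ['X^q - 'X] has no more than [q] roots. *)
Lemma frobenius_fixed_im (F : finFieldType) (g : {rmorphism F -> E}) :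
  #|F| = q -> forall x : E, x ^+ q = x -> exists a, x = g a.
Proof.
move=> cardF x xq; suff: x \in g @: setT by case/imsetP=> a; exists a.
have /eqP -> : g @: setT == [set x : E | x ^+ q == x]; last by rewrite inE xq.
rewrite eqEcard card_imset; last exact: fmorph_inj.
rewrite cardsT cardF card_frobenius_fixed andbT.
by apply/subsetP => _ /imsetP[a _ ->]; rewrite inE -rmorphXn -cardF expf_card.
Qed.

Lemma norm_surjective (v : E) :
  v != 0 -> v ^+ q = v -> exists2 l : E, l != 0 & l ^+ q.+1 = v.
Proof.
move=> v0 vq; have [w wP] := finField_prim_root E.
have q1 := sqrt_card_gt1.
have cE : #|E|.-1 = (q.-1 * q.+1)%N.
  rewrite cardE -[q in (q ^ 2)%N]prednK 1?ltnW // -subn1 -[1%N in LHS](exp1n 2).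
  by rewrite subn_sqr subn1 prednK 1?ltnW // addn1.
have [[j /= _] vE] := prim_rootP wP (finField_unity v0).
have : v ^+ q.-1 = 1 by apply: (mulfI v0); rewrite -exprS prednK ?mulr1 // ltnW.
(* With [v = w ^+ j], the order [(q - 1)(q + 1)] of [w] divides [j (q - 1)], so [q + 1] divides
   [j]. *)
move/eqP; rewrite vE -exprM -(prim_order_dvd wP) cE mulnC dvdn_pmul2r; last first.
  by rewrite -ltnS prednK // ltnW.
case/dvdnP=> r ->; exists (w ^+ r); last by rewrite -exprM.
rewrite expf_neq0 //; apply/eqP => w0; have := prim_expr_order wP.
by rewrite w0 expr0n eqn0Ngt (prim_order_gt0 wP) => /eqP; rewrite eq_sym oner_eq0.
Qed.

End Frobenius.

(** * Two by two matrices and the symplectic form *)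

Definition mx22 (R : Type) (a b c d : R) : 'M[R]_2 :=
  \matrix_(i, j) if i == 0 then if j == 0 then a else b else if j == 0 then c else d.

Lemma mx22P (R : Type) (A : 'M[R]_2) : A = mx22 (A 0 0) (A 0 1) (A 1 0) (A 1 1).
Proof.
apply/matrixP => i j; rewrite mxE.
by case: (altP eqP) => [->|] /=; case: (altP eqP) => [->|];
   case: i => [[|[|[]]] ?] //; case: j => [[|[|[]]] ?] // *; congr (A _ _); apply: val_inj.
Qed.

Lemma mx22M (R : comNzRingType) (a b c d a' b' c' d' : R) :
  mx22 a b c d *m mx22 a' b' c' d'
  = mx22 (a * a' + b * c') (a * b' + b * d') (c * a' + d * c') (c * b' + d * d').
Proof.
apply/matrixP => i j; rewrite !mxE !big_ord_recl big_ord0 !mxE /= addr0.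
by case: (i == 0); case: (j == 0).
Qed.

Lemma mx22T (R : Type) (a b c d : R) : (mx22 a b c d)^T = mx22 a c b d.
Proof. by apply/matrixP => i j; rewrite !mxE; case: (i == 0); case: (j == 0). Qed.

Lemma mx22Z (R : nzRingType) (k a b c d : R) :
  k *: mx22 a b c d = mx22 (k * a) (k * b) (k * c) (k * d).
Proof. by apply/matrixP => i j; rewrite !mxE; case: (i == 0); case: (j == 0). Qed.

Lemma det_mx22E (R : comNzRingType) (a b c d : R) :
  \det (mx22 a b c d) = a * d - b * c.
Proof.
rewrite (expand_det_row _ 0) !big_ord_recl big_ord0 /cofactor !det_mx11 !mxE /=.
by rewrite expr0 expr1; ring.
Qed.

Lemma trmxZ (R : pzRingType) (m n : nat) (l : R) (A : 'M[R]_(m, n)) :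
  (l *: A)^T = l *: A^T.
Proof. exact: linearZ. Qed.

Definition symp_mx (R : nzRingType) : 'M[R]_2 := mx22 0 1 (- 1) 0.

Lemma trmx_symp (R : nzRingType) : (symp_mx R)^T = - symp_mx R.
Proof.
apply/matrixP => i j; rewrite !mxE.
by case: (i == 0); case: (j == 0); rewrite ?oppr0 ?opprK.
Qed.

Lemma symp_unit (R : comUnitRingType) : symp_mx R \in unitmx.
Proof. by rewrite unitmxE det_mx22E mulr0 mul1r opprK add0r unitr1. Qed.

(** Alternating forms on a plane make up a line, on which [A] acts by its determinant. *)
Lemma symp_similitude (R : comNzRingType) (A : 'M[R]_2) :
  A^T *m symp_mx R *m A = \det A *: symp_mx R.
Proof.
rewrite (mx22P A) mx22T !mx22M det_mx22E mx22Z.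
by congr mx22; ring.
Qed.

(** * Base change and scalars in ['GL_2] *)

Lemma GLval_inj (n : nat) (R : finComUnitRingType) :
  injective (@GLval n R).
Proof. exact: val_inj. Qed.

(** The default [1] is never reached, since field morphisms preserve invertibility of matrices. *)
Definition GLmap (F E : finFieldType) (g : {rmorphism F -> E}) (x : {'GL_2[F]}) :
    {'GL_2[E]} := insubd (1%g : {'GL_2[E]}) (map_mx g (GLval x)).

Lemma GLmapE (F E : finFieldType) (g : {rmorphism F -> E}) (x : {'GL_2[F]}) :
  GLval (GLmap g x) = map_mx g (GLval x).
Proof. by apply: insubdK; rewrite [_ \in _]map_unitmx; apply: GL_unitmx. Qed.

Lemma GLmapM (F E : finFieldType) (g : {rmorphism F -> E}) :
  {morph GLmap g : x y / (x * y)%g}.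
Proof. by move=> x y; apply: GLval_inj; rewrite GL_MxE !GLmapE GL_MxE -map_mxM. Qed.

Lemma GLmap_inj (F E : finFieldType) (g : {rmorphism F -> E}) : injective (GLmap g).
Proof.
move=> x y /(congr1 (@GLval _ _)); rewrite !GLmapE => /matrixP e.
by apply/GLval_inj/matrixP => i j; have := e i j; rewrite !mxE => /fmorph_inj.
Qed.

Lemma GL_lift (E : finFieldType) (A : 'M[E]_2) :
  A \in unitmx -> exists u : {'GL_2[E]}, GLval u = A.
Proof. by move=> uA; exists (insubd (1%g : {'GL_2[E]}) A); apply: insubdK. Qed.

Lemma coset_scale (E : finFieldType) (l : E) (a b : {'GL_2[E]}) :
  GLval b = l *: GLval a -> coset 'Z('GL_2[E])%g b = coset 'Z('GL_2[E])%g a.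
Proof.
move=> e; rewrite -[b in LHS](mulgKV a); apply: coset_kerl.
have zE : GLval (b * a^-1)%g = l%:M.
  by rewrite GL_MxE GL_VxE e -scalemxAl mulmxV ?GL_unitmx // scalemx1.
apply/centerP; split=> [|u _]; first by rewrite inE.
by apply: GLval_inj; rewrite GL_MxE [RHS]GL_MxE zE scalar_mxC.
Qed.

(** * Descent to [F] and the untwisting matrix [P] *)

Section Conjugation.

Variables (E : finFieldType) (q : nat).
Hypothesis cardE : #|E| = (q ^ 2)%N.
Local Notation J := (symp_mx E).

Lemma conj_mxZ (l : E) (A : 'M[E]_2) : conj_mx q (l *: A) = l ^+ q *: conj_mx q A.
Proof. by apply/matrixP => i j; rewrite !mxE exprMn. Qed.

Lemma conj_mx_map (F : finFieldType) (g : {rmorphism F -> E}) (X : 'M[F]_2) :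
  #|F| = q -> conj_mx q (map_mx g X) = map_mx g X.
Proof. by move=> cF; apply/matrixP => i j; rewrite !mxE -rmorphXn -cF expf_card. Qed.

(* No Hilbert 90 is needed: dividing by any nonzero entry removes mu. *)
Lemma conj_mx_descent (F : finFieldType) (g : {rmorphism F -> E}) (mu : E) (B : 'M[E]_2) :
    #|F| = q -> B \in unitmx -> conj_mx q B = mu *: B ->
  exists l : E, exists2 X : 'M[F]_2, X \in unitmx & B = l *: map_mx g X.
Proof.
move=> cF uB Bmu.
have [[i0 j0] /= b0] : exists ij : 'I_2 * 'I_2, B ij.1 ij.2 != 0.
  apply/existsP; apply: contraLR uB; rewrite negb_exists => /forallP B0.
  rewrite unitmxE (_ : B = 0) ?det0 ?unitr0 //; apply/matrixP => i j; rewrite mxE.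
  by apply/eqP; have:= B0 (i, j); rewrite negbK.
have eB i j : (B i j) ^+ q = mu * B i j by have /matrixP/(_ i j) := Bmu; rewrite !mxE.
set b := B i0 j0 in b0.
have bq : b ^+ q = mu * b by apply: eB.
have mu0 : mu != 0.
  by apply: contraNneq (expf_neq0 q b0) => mu0; rewrite bq mu0 mul0r.
have fixed i j : exists a, B i j / b == g a.
  have [|a ->] := frobenius_fixed_im cardE g cF (x := B i j / b); last by exists a.
  by rewrite exprMn exprVn eB bq -mulf_div divff // mul1r.
pose X := \matrix_(i, j) xchoose (fixed i j).
have BX : B = b *: map_mx g X.
  apply/matrixP => i j; rewrite !mxE -(eqP (xchooseP (fixed i j))).
  by rewrite mulrC divfK.
exists b, X => //; move: uB.
by rewrite BX unitmxZ ?unitfE // map_unitmx.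
Qed.

(* The rows of P are (1, y) and c^-1 times its conjugate, with c of norm -1. *)
Lemma exists_untwist : exists2 P : 'M[E]_2, P \in unitmx &
  exists2 c : E, c != 0 & conj_mx q P = c *: (J *m P).
Proof.
have [y yq] := frobenius_nonfixed cardE.
have q0 : 0 ^+ q = 0 :> E by rewrite expr0n eqn0Ngt (q_gt0 cardE).
(* Additivity of the [q]-power map, applied to [-1 + 1 = 0], avoids a case split on the parity of
   [q]. *)
have m1q : (-1) ^+ q = -1 :> E.
  apply/eqP; rewrite -addr_eq0; apply/eqP.
  by rewrite -{2}(expr1n E q) -(conjD cardE) addNr q0.
have m10 : (-1 : E) != 0 by rewrite oppr_eq0 oner_eq0.
have [c c0 cq] := norm_surjective cardE m10 m1q.
have cV : (c^-1) ^+ q = - c.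
  apply: (mulfI (expf_neq0 q c0)); rewrite -exprMn divff // expr1n.
  by rewrite mulrN -exprSr cq opprK.
exists (mx22 1 y c^-1 (y ^+ q / c)).
  (* The determinant is [(y ^+ q - y) / c], nonzero because [y] is not fixed. *)
  rewrite unitmxE det_mx22E mul1r -mulrBl unitfE mulf_neq0 ?invr_eq0 //.
  by rewrite subr_eq0.
exists c => //; rewrite mx22M mx22Z.
have yqq : (y ^+ q) ^+ q = y by rewrite -exprM mulnn -cardE expf_card.
apply/matrixP => i j; rewrite !mxE.
case: (i == 0); case: (j == 0).
- by rewrite expr1n mul0r add0r mul1r divff.
- by rewrite mul0r add0r mul1r mulrC divfK.
- by rewrite mul0r addr0 mulr1 mulrN1 cV.
- by rewrite exprMn yqq cV; ring.
Qed.

Section Untwist.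

Variables (P : 'M[E]_2) (c : E).
Hypotheses (uP : P \in unitmx) (c0 : c != 0) (Pc : conj_mx q P = c *: (J *m P)).

Lemma conj_untwist (A B : 'M[E]_2) :
  A *m P = P *m B -> conj_mx q A *m J *m P = J *m P *m conj_mx q B.
Proof.
move/(congr1 (conj_mx q)); rewrite !(conj_mxM cardE) Pc -scalemxAr -scalemxAl.
by move/(scalerI c0); rewrite !mulmxA.
Qed.

(** Multiplying [conj_untwist] by [A^T] removes [conj_mx q A] by unitarity; then
    [A^T J = det(A) J A^-1] leaves [A P = det(A) P conj(B)], where [A P = P B]. *)
Lemma unitary_untwist (A B : 'M[E]_2) :
    A \in unitmx -> A *m P = P *m B -> (conj_mx q A)^T *m A = 1%:M ->
  conj_mx q B = (\det A)^-1 *: B.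
Proof.
move=> uA AB UA; have dA : \det A != 0 by rewrite -unitfE -unitmxE.
have UA' : A^T *m conj_mx q A = 1%:M by rewrite -[LHS]trmxK trmx_mul trmxK UA trmx1.
have := congr1 (mulmx A^T) (conj_untwist AB); rewrite !mulmxA UA' mul1mx.
have -> : A^T *m J = \det A *: (J *m invmx A).
  by rewrite -[LHS](mulmxK uA) symp_similitude scalemxAl.
rewrite -!scalemxAl -!mulmxA scalemxAr => /(can_inj (mulKmx (symp_unit E))).
move=> PB; apply: (can_inj (mulKmx uP)); rewrite -scalemxAr -AB.
rewrite [X in A *m X]PB.
by rewrite -scalemxAr mulKVmx // scalerA mulVf // scale1r.
Qed.

(** Here [conj_untwist] reduces to [conj(A) J = J A]; its transpose turns [J conj(A)^T A] into
    [A^T J A]. The result is unitary only up to the factor [\det A]. *)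
Lemma rational_similitude (A B : 'M[E]_2) :
    A *m P = P *m B -> conj_mx q B = B ->
  (conj_mx q A)^T *m A = (\det A)%:M.
Proof.
move=> AB Bq; have := conj_untwist AB; rewrite Bq -[in RHS]mulmxA -AB mulmxA.
move/(can_inj (mulmxK uP))/(congr1 trmx); rewrite !trmx_mul trmx_symp mulNmx mulmxN.
move/oppr_inj => JA; apply: (can_inj (mulKmx (symp_unit E))).
by rewrite mulmxA JA symp_similitude mul_mx_scalar.
Qed.

End Untwist.

End Conjugation.

(** * Equality of the two images *)

Theorem proposition3p3 (q : nat) (F E : finFieldType)
  (cardF : #|F| = q) (cardE : #|E| = (q ^ 2)%N) (n : nat) (n_ge2 : (2 <= n)%N) :
  cp n 'GL_2[F]%G = cp n (U2 cardE).
Proof.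
have [g] : inhabited {rmorphism F -> E}.
  by apply: (@finField_embedding _ _ 2); rewrite cardF.
have [P uP [c c0 Pc]] := exists_untwist cardE.
have [h hP] := GL_lift uP.
pose Z := 'Z('GL_2[E])%G.
have nZ x : x \in 'N(Z)%g.
  by apply: (subsetP (normal_norm (center_normal 'GL_2[E]))); rewrite inE.
(* Conjugating by [h^-1] sends [x] to [P x P^-1], which aligns its class with that of a unitary
   matrix. *)
pose f1 x := coset Z (GLmap g x ^ h^-1)%g.
have f1A x : GLval (GLmap g x ^ h^-1)%g *m P = P *m map_mx g (GLval x).
  by rewrite -hP -GLmapE -!GL_MxE conjgE invgK mulgA mulgKV.
apply: (@cp_eq_image _ _ _ _ _ f1 (coset Z) (@coset_commute _ Z)).
- by move=> x y _ _; rewrite /f1 GLmapM conjMg morphM.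
- by move=> x y _ _; rewrite morphM.
- move=> x y _ _; rewrite coset_center_commute ?inE // -!conjMg -!GLmapM.
  by rewrite (inj_eq (conjg_inj _)) (inj_eq (@GLmap_inj _ _ g)).
- by move=> x y _ _; rewrite coset_center_commute ?inE.
apply/setP => u; apply/imsetP/imsetP => [[x _ ->]|[a Ua ->]].
  set A := (GLmap g x ^ h^-1)%g.
  have AU := rational_similitude cardE uP c0 Pc (f1A x) (conj_mx_map g _ cardF).
  have detA : \det (GLval A) = g (\det (GLval x)).
    have:= congr1 (fun M => \det M) (f1A x); rewrite !det_mulmx det_map_mx mulrC.
    by apply: mulfI; rewrite -unitfE -unitmxE.
  have d0 : (\det (GLval A))^-1 != 0 by rewrite invr_eq0 GL_det.
  (* Scaling [A] by [l] multiplies the Hermitian product by [l ^+ q.+1], the inverse of [\det A], so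
     [l *: A] is unitary with the same coset. The norm equation is solvable because [\det A] comes
     from [F]. *)
  have [|l l0 lq] := norm_surjective cardE d0.
    by rewrite detA exprVn -rmorphXn -cardF expf_card.
  have ulA : l *: GLval A \in unitmx by rewrite unitmxZ ?unitfE // GL_unitmx.
  have [b bE] := GL_lift ulA.
  exists b; last by rewrite (coset_scale bE).
  rewrite inE bE conj_mxZ trmxZ -scalemxAl -scalemxAr scalerA AU -exprSr lq.
  by rewrite scale_scalar_mx mulVf // GL_det.
move: Ua; rewrite inE => /eqP Ua.
set B := (a ^ h)%g.
have AB : GLval a *m P = P *m GLval B.
  by rewrite -hP; apply: (congr1 (@GLval 2 E) (conjgC a h)).
have Bq := unitary_untwist cardE uP c0 Pc (GL_unitmx a) AB Ua.
(* Conversely [B = P^-1 a P] is proportional to its conjugate, hence to a matrix over [F]; the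
   scalar [l] disappears in the quotient. *)
have [l [X uX BX]] := conj_mx_descent cardE g cardF (GL_unitmx B) Bq.
have [x xX] := GL_lift uX.
exists x; first by rewrite inE.
apply: (@coset_scale _ l); apply: (can_inj (mulmxK uP)).
by rewrite AB -scalemxAl f1A xX [GLval B]BX scalemxAr.
Qed.
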